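(* Let $X$ be a compact complex manifold, $G$ a connected complex Lie group, $H<G$ a closed connected complex Lie subgroup, and let $(E_H,A)$ be a holomorphic Cartan geometry of type $(G,H)$ on $X$. Then the space $T^0(E_H,A)$ of infinitesimal automorphisms of $(E_H,A)$ is equal to $$T^0(E_H,A)=H^0(X,\mathrm{ad}(E_H))_A:=\{\psi\in H^0(X,\mathrm{ad}(E_H))\mid L_\psi(A)=0\}.$$
   Context: Let $\mathfrak g=\mathrm{Lie}(G)$, $\mathfrak h=\mathrm{Lie}(H)$. For a holomorphic principal $H$-bundle $\pi:E_H\to X$, the group $H$ acts on $T_{E_H}$ by $v\cdot h=(R_h)_*v$ ($R_h$ the right translation by $h$) and on $\mathfrak g$ by $\gamma\mapsto \mathrm{Ad}(h^{-1})(\gamma)$. A holomorphic Cartan geometry of type $(G,H)$ on $X$ is a pair $(E_H,A)$, where $E_H$ is a holomorphic principal $H$-bundle on $X$ and $A:T_{E_H}\to E_H\times\mathfrak g$ is a $\mathbb C$-linear holomorphic isomorphism of vector bundles over $E_H$ (equivalently, a $\mathfrak g$-valued holomorphic 1-form on $E_H$) such that (i) $A$ is $H$-equivariant, and (ii) the restriction of $A$ to the fibers of $E_H\to X$ is the ($\mathfrak h$-valued) Maurer-Cartan form for the action of $H$. An isomorphism $(E_H,A)\to(F_H,B)$ of Cartan geometries is a holomorphic isomorphism $\phi:E_H\to F_H$ of principal $H$-bundles over $X$ with $B\circ\phi_*=(\phi\times \mathrm{id}_{\mathfrak g})\circ A$. The adjoint bundle is $\mathrm{ad}(E_H)=E_H\times_H\mathfrak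 h=\ker(\pi_* )/H$, where $\pi_*:T_{E_H}\to T_X$. A holomorphic section $\psi$ of $\mathrm{ad}(E_H)$ is identified with the corresponding $H$-invariant vertical holomorphic vector field on $E_H$, and $L_\psi$ denotes the Lie derivative with respect to this vector field. Infinitesimal automorphisms of $E_H$ (over $X$) are the elements $\psi\in H^0(X,\mathrm{ad}(E_H))$; the space $T^0(E_H,A)$ (degree-zero tangent cohomology) consists of those which are compatible with the Cartan geometry, that is, the infinitesimal version of the condition of being an automorphism of $(E_H,A)$: with $\mathbb C[\epsilon]=\mathbb C[t]/(t^2)$ and $D$ the double point with $\mathcal O_D=\mathbb C[\epsilon]$, the automorphism $\mathrm{id}+\epsilon\psi$ of the trivial family $E_H\times D$ preserves the trivial extension of $A$. *)

(* Defs.v *)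
From HB Require Import structures.
From mathcomp Require Import all_boot all_order all_algebra complex.
From mathcomp Require Import all_classical all_reals all_analysis.

Set Implicit Arguments.
Unset Strict Implicit.
Unset Printing Implicit Defensive.

Import Order.TTheory GRing.Theory Num.Theory.
Import numFieldNormedType.Exports.

Local Open Scope classical_set_scope.
Local Open Scope ring_scope.

Definition C (R : realType) : numFieldType := R[i].

(* A map between open subsets of spaces of the form 'rV[C R]_n is holomorphic
   when it is [differentiable] (over C R, hence complex differentiable) at
   every point. *)

Record chart (R : realType) (n : nat) (M : topologicalType) := Chart {
  chart_dom : set M;
  chart_fun :> M -> 'rV[C R]_n;
  chart_inv : 'rV[C R]_n -> M;
  chart_dom_open : open chart_dom;
  chart_img_open : open (chart_fun @` chart_dom);
  chart_funK : forall x, chart_dom x -> chart_inv (chart_fun x) = x;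
  chart_fun_cont : {in chart_dom, continuous chart_fun};
  chart_inv_cont : {in chart_fun @` chart_dom, continuous chart_inv}
}.

HB.mixin Record isComplexManifold (R : realType) (n : nat) M
    of Topological M := {
  atlas : set (chart R n M);
  chart_at : M -> chart R n M;
  chart_at_atlas : forall x, atlas (chart_at x);
  chart_at_dom : forall x, chart_dom (chart_at x) x;
  atlas_compatible : forall c d, atlas c -> atlas d ->
    forall x, chart_dom c x -> chart_dom d x ->
    differentiable (d \o chart_inv c) (c x);
  manifold_hausdorff : hausdorff_space M;
  manifold_second_countable : @second_countable M
}.

#[short(type="complexManifold")]
HB.structure Definition ComplexManifold (R : realType) (n : nat) :=
  {M of isComplexManifold R n M & Topological M}.

Section Manifold.
Context {R : realType} {n : nat} {M : complexManifold R n}.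

(* T_x M is coordinatized by the preferred chart at x: v : tangent x stands for
   the tangent vector whose coordinates in the chart [chart_at x] are v. *)
Definition tangent (x : M) : normedModType (C R) := 'rV[C R]_n.

(* coordinates of v in the chart c, and its inverse: the tangent vector at x
   with given coordinates in c; [tvec c x (delta_mx 0 i)] is d/dz_i at x *)
Definition tcoord (c : chart R n M) (x : M) (v : tangent x) : 'rV[C R]_n :=
  'd (c \o chart_inv (chart_at x)) (chart_at x x) v.

Definition tvec (c : chart R n M) (x : M) (w : 'rV[C R]_n) : tangent x :=
  'd (chart_at x \o chart_inv c) (c x) w.

(* the derivative v(f) = df(v) of a vector-valued function f *)
Definition vderiv (W : normedModType (C R)) (f : M -> W) (x : M)
    (v : tangent x) : W :=
  'd (f \o chart_inv (chart_at x)) (chart_at x x) v.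

Definition holomorphic_field (U : set M) (Y : forall x : M, tangent x) :=
  forall (c : chart R n M) (x : M), atlas c -> chart_dom c x -> U x ->
  differentiable (fun z => tcoord c (Y (chart_inv c z))) (c x).

Definition holomorphic_form (W : normedModType (C R))
    (A : forall x : M, {linear tangent x -> W}) :=
  forall (c : chart R n M) (x : M) (w : 'rV[C R]_n), atlas c -> chart_dom c x ->
  differentiable (fun z => A (chart_inv c z) (tvec c (chart_inv c z) w)) (c x).

(* [Y, Z]^i = Y(Z^i) - Z(Y^i), at x in the coordinates of [chart_at x] *)
Definition bracket (Y Z : forall x : M, tangent x) (x : M) : tangent x :=
  vderiv (fun y => tcoord (chart_at x) (Z y)) (Y x) -
  vderiv (fun y => tcoord (chart_at x) (Y y)) (Z x).

(* (L_psi A)(Y) = psi(A(Y)) - A([psi, Y]) *)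
Definition lie_derivative (W : normedModType (C R))
    (psi : forall x : M, tangent x) (A : forall x : M, {linear tangent x -> W})
    (Y : forall x : M, tangent x) (x : M) : W :=
  vderiv (fun y => A y (Y y)) (psi x) - A x (bracket psi Y x).

(* L_psi A = 0 as a 1-form: it vanishes on all local holomorphic fields Y *)
Definition lie_derivative_eq0 (W : normedModType (C R))
    (psi : forall x : M, tangent x)
    (A : forall x : M, {linear tangent x -> W}) :=
  forall (U : set M) (Y : forall x : M, tangent x),
  open U -> holomorphic_field U Y ->
  forall x, U x -> lie_derivative psi A Y x = 0.

End Manifold.

Section Maps.
Context {R : realType} {n p q : nat}.
Context {M : complexManifold R n} {N : complexManifold R p}.
Context {P : complexManifold R q}.

Definition mdifferentiable (f : M -> N) (x : M) :=
  {for x, continuous f} /\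
  differentiable (chart_at (f x) \o f \o chart_inv (chart_at x)) (chart_at x x).

Definition holomorphic_on (U : set M) (f : M -> N) :=
  forall x, U x -> mdifferentiable f x.

Definition mdiff (f : M -> N) (x : M) (v : tangent x) : tangent (f x) :=
  'd (chart_at (f x) \o f \o chart_inv (chart_at x)) (chart_at x x) v.

(* holomorphy of (x, y) |-> f x y on a subset of the product manifold M x N,
   with respect to product charts *)
Definition holomorphic2_on (U : set (M * N)) (f : M -> N -> P) :=
  forall x y, U (x, y) ->
  {for (x, y), continuous (fun a : M * N => f a.1 a.2)} /\
  differentiable
    (fun z : 'rV[C R]_n * 'rV[C R]_p =>
       (chart_at (f x y) : chart R q P)
         (f (chart_inv (chart_at x) z.1) (chart_inv (chart_at y) z.2)))
    ((chart_at x : chart R n M) x, (chart_at y : chart R p N) y).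

End Maps.

HB.mixin Record isComplexLieGroup (R : realType) (n : nat) G
    of ComplexManifold R n G & Group G := {
  lie_mul_holomorphic :
    holomorphic2_on setT (fun x y : G => (x * y)%g : G);
  lie_inv_holomorphic : holomorphic_on setT (fun x : G => (x^-1)%g : G)
}.

#[short(type="complexLieGroup")]
HB.structure Definition ComplexLieGroup (R : realType) (n : nat) :=
  {G of isComplexLieGroup R n G & ComplexManifold R n G & Group G}.

Definition lie_algebra (R : realType) (n : nat) (G : complexLieGroup R n) :
  normedModType (C R) := tangent (1%g : G).

(* Ad(g) = d(x |-> g x g^-1)_1; the target g 1 g^-1 is 1 *)
Definition Ad (R : realType) (n : nat) (G : complexLieGroup R n) (g : G) :
    lie_algebra G -> lie_algebra G :=
  @mdiff R n n G G (fun x : G => (g * x * g^-1)%g) 1%g.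

(* The subgroup is given by its inclusion: a group morphism which is a
   holomorphic immersion and a closed topological embedding. *)
Record closed_lie_subgroup (R : realType) (k m : nat)
    (H : complexLieGroup R k) (G : complexLieGroup R m) := ClosedLieSubgroup {
  incl :> H -> G;
  inclM : forall x y : H, incl (x * y)%g = (incl x * incl y)%g;
  incl_inj : injective incl;
  incl_holomorphic : holomorphic_on setT incl;
  incl_immersion : forall x : H, injective (@mdiff R k m H G incl x);
  incl_closed : forall F : set H, closed F -> closed (incl @` F)
}.

Record principal_bundle (R : realType) (n k d : nat)
    (X : complexManifold R n) (H : complexLieGroup R k)
    (E : complexManifold R d) := PrincipalBundle {
  proj : E -> X;
  act : E -> H -> E;
  act1 : forall e, act e 1%g = e;
  actM : forall e (g h : H), act e (g * h)%g = act (act e g) h;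
  proj_act : forall e h, proj (act e h) = proj e;
  proj_holomorphic : holomorphic_on setT proj;
  act_holomorphic : holomorphic2_on setT act;
  (* over U, (proj, tau) and sigma are mutually inverse, H-equivariant and
     holomorphic between proj^-1(U) and U x H *)
  local_triviality : forall x : X, exists (U : set X) (tau : E -> H)
      (sigma : X -> H -> E),
    [/\ open U, U x,
        [/\ holomorphic_on (proj @^-1` U) tau &
            forall e h, U (proj e) -> tau (act e h) = (tau e * h)%g],
        holomorphic2_on (U `*` setT) sigma &
        [/\ forall e, U (proj e) -> sigma (proj e) (tau e) = e,
            forall y h, U y -> proj (sigma y h) = y &
            forall y h, U y -> tau (sigma y h) = h]]
}.

Section CartanGeometry.
Context {R : realType} {n k m d : nat}.
Context {X : complexManifold R n} {H : complexLieGroup R k}.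
Context {G : complexLieGroup R m} {E : complexManifold R d}.

Record cartan_geometry (iota : closed_lie_subgroup H G)
    (P : principal_bundle X H E) := CartanGeometry {
  cartan_form :> forall e : E, {linear tangent e -> lie_algebra G};
  cartan_holomorphic : holomorphic_form cartan_form;
  (* fibrewise inverse, also holomorphic: A is an isomorphism T_E -> E x g *)
  cartan_iso : exists B : forall e : E, lie_algebra G -> tangent e,
    [/\ forall e, cancel (cartan_form e) (B e),
        forall e, cancel (B e) (cartan_form e) &
        forall gamma, holomorphic_field setT (fun e => B e gamma)];
  cartan_equivariant : forall (e : E) (h : H) (v : tangent e),
    cartan_form (act P e h) (mdiff (act P ^~ h) v) =
    Ad (iota h^-1%g) (cartan_form e v);
  (* the vertical vectors at e are the images of gamma in Lie(H) under the
     differential of the orbit map h |-> e h *)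
  cartan_maurer_cartan : forall (e : E) (gamma : lie_algebra H),
    cartan_form e (@mdiff R k d H E (act P e) 1%g gamma) =
    @mdiff R k m H G iota 1%g gamma
}.

(* sections of ad(E_H) = ker(d proj)/H, seen as the H-invariant vertical holomorphic vector fields *)
Definition H0_ad (P : principal_bundle X H E) :
    set (forall e : E, tangent e) :=
  [set psi | [/\ holomorphic_field setT psi,
    forall e, mdiff (proj P) (psi e) = 0 &
    forall e h, mdiff (act P ^~ h) (psi e) = psi (act P e h)]].

End CartanGeometry.

Section DoublePoint.
Context {R : realType} {d : nat} {E : complexManifold R d}.
Variable psi : forall e : E, tangent e.

(* A pair (a, b) : W * W stands for a + eps b in W[eps], eps^2 = 0.  Functions
   on E x D with values in W are functions E -> W * W. *)

Definition eps_scale (W : normedModType (C R)) (s : C R * C R) (a : W * W) :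
  W * W := (s.1 *: a.1, s.1 *: a.2 + s.2 *: a.1).

(* pullback of functions under the automorphism id + eps psi of E x D over D:
   the eps-linear map f0 + eps f1 |-> f0 + eps (f1 + psi(f0)) *)
Definition eps_pull_fun (W : normedModType (C R)) (f : E -> W * W) (x : E) :
  W * W := ((f x).1, (f x).2 + vderiv (fst \o f) (psi x)).

(* the differential relative to D *)
Definition eps_d (W : normedModType (C R)) (f : E -> W * W) (x : E)
  (v : tangent x) : W * W := (vderiv (fst \o f) v, vderiv (snd \o f) v).

Definition eps_form (W : normedModType (C R)) :=
  forall e : E, tangent e -> W * W.

Definition trivial_extension (W : normedModType (C R))
    (A : forall e : E, {linear tangent e -> W}) : eps_form W :=
  fun e v => (A e v, 0).

Definition eps_coord (c : chart R d E) (i : 'I_d) (x : E) :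
  (C R)^o * (C R)^o := (c x 0 i, 0).

Definition eps_coef (W : normedModType (C R)) (alpha : eps_form W)
  (c : chart R d E) (i : 'I_d) (x : E) : W * W :=
  alpha x (tvec c x (delta_mx 0 i)).

(* Pullback phi^* of W-valued 1-forms on E x D relative to D, for
   phi = id + eps psi: writing alpha = sum_i a_i dz_i in the chart z at x,
   phi^* alpha = sum_i phi^*(a_i) d(phi^* z_i). *)
Definition eps_pull_form (W : normedModType (C R)) (alpha : eps_form W) :
    eps_form W :=
  fun x v => \sum_(i < d)
    eps_scale (eps_d (eps_pull_fun (eps_coord (chart_at x) i)) v)
              (eps_pull_fun (eps_coef alpha (chart_at x) i) x).

End DoublePoint.

(* psi such that phi = id + eps psi preserves the trivial extension of A, that
   is A o phi_* = (phi x id) o A, or phi^* A = A *)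
Definition T0 (R : realType) (n k m d : nat) (X : complexManifold R n)
    (H : complexLieGroup R k) (G : complexLieGroup R m)
    (E : complexManifold R d) (iota : closed_lie_subgroup H G)
    (P : principal_bundle X H E) (A : cartan_geometry iota P) :
    set (forall e : E, tangent e) :=
  [set psi | H0_ad P psi /\
    forall (e : E) (v : tangent e),
      eps_pull_form psi (trivial_extension A) v = trivial_extension A v].

(* Main.v *)
(** Fix a point x and work in the preferred chart z at x.  Write
    A = sum_i a_i dz_i and psi = sum_i psi_i d/dz_i.  The eps-coefficient of
    (id + eps psi)^* A, evaluated at a tangent vector v, is
    sum_i (psi(a_i) v_i + v(psi_i) a_i), and the Leibniz rule applied to
    A(Y) = sum_i a_i Y_i shows that (L_psi A)(Y) has the same value at x for
    every holomorphic field Y with Y(x) = v.  It remains to extend every tangent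
    vector v to a holomorphic field: the inverse of the Cartan isomorphism maps
    the constant section A(v) to such a field.  (With constant coefficients in a
    chart, one would have to know that the differential of a holomorphic
    transition map is again holomorphic.) *)

Require Import Defs.
From HB Require Import structures.
From mathcomp Require Import all_boot all_order all_algebra complex.
From mathcomp Require Import all_classical all_reals all_analysis.

Set Implicit Arguments.
Unset Strict Implicit.

Local Open Scope classical_set_scope.

Import Order.TTheory GRing.Theory Num.Theory.
Import numFieldNormedType.Exports.
Local Open Scope ring_scope.

(** * Locality of the differential and the Leibniz rule *)

Section Differentials.
Context {K : numFieldType} {V W : normedModType K}.

Lemma diff_eq (f df : V -> W) (x : V) :
  is_diff x f df -> forall v, 'd f x v = df v.
Proof. by move=> fdf v; rewrite diff_val. Qed.

(** The first-order expansion of [f] at [x] only involves values near [x], so it is also one of [g];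
    uniqueness of the differential concludes. *)
Lemma is_diff_near (f g df : V -> W) (x : V) :
  (\forall y \near x, f y = g y) -> is_diff x f df -> is_diff x g df.
Proof.
move=> fg fdf; have df_diff := @ex_diff _ _ _ _ _ _ _ fdf.
have [dfc dfo] := (diff_locallyP x f).1 df_diff.
have fgx : f x = g x by exact: nbhs_singleton fg.
have go : g \o shift x = cst (g x) + 'd f x +o_ 0 id.
  apply/eqaddoP => _/posnumP[eps].
  move/eqaddoP: dfo => /(_ eps%:num (gt0 eps)) dfo.
  have sfg : \forall h \near (0 : V), f (h + x) = g (h + x).
    by move: fg; rewrite (near_shift 0) /= subr0.
  near=> h.
  have fgh : f (h + x) = g (h + x) by near: h.
  have : `|(f \o shift x - (cst (f x) + 'd f x)) h| <= eps%:num * `|h|.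
    by near: h.
  by rewrite /= !fctE /= /shift /= fgh fgx.
have dE := @diff_unique _ _ _ g ('d f x) x dfc go.
apply: DiffDef; last by rewrite dE (@diff_val _ _ _ _ _ _ _ fdf).
by apply/diff_locallyP; rewrite dE; split.
Unshelve. all: by end_near. Qed.

Lemma near_diff_comp {V' : normedModType K} (f : V -> V') (g : V' -> W)
    (h : V -> W) (x : V) (y : V') :
  f x = y -> differentiable f x -> differentiable g y ->
  (\forall z \near x, g (f z) = h z) ->
  forall v, 'd g y ('d f x v) = 'd h x v.
Proof.
move=> <-{y} /differentiableP fd /differentiableP gd gfh v.
by rewrite (diff_eq (is_diff_near gfh (is_diff_comp fd gd))).
Qed.

Lemma is_diff_sum (I : finType) (f df : I -> V -> W) (x : V) :
  (forall i, is_diff x (f i) (df i)) ->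
  is_diff x (fun z => \sum_i f i z) (fun v => \sum_i df i v).
Proof.
move=> fdf.
rewrite (_ : (fun z => _) = \sum_i f i); last first.
  by apply/funext => z; rewrite fct_sumE.
rewrite (_ : (fun v => _) = \sum_i df i); last first.
  by apply/funext => z; rewrite fct_sumE.
by elim/big_ind2: _ => [|*|//]; [exact: is_diff_cst|exact: is_diffD].
Qed.

Lemma is_diff_scale_fun (k dk : V -> K^o) (f df : V -> W) (x : V) :
  is_diff x k dk -> is_diff x f df ->
  is_diff x (fun z => k z *: f z) (fun v => k x *: df v + dk v *: f x).
Proof.
move=> kdk fdf.
(* Scaling is packed as a continuous bilinear map, whose differential is known; composing it with
   the pair [(k, f)] gives the Leibniz rule. *)
have sl : bilinear_for (GRing.Scale.Law.clone _ _ *:%R _)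
    (GRing.Scale.Law.clone _ _ *:%R _) (fun (k : K^o) (w : W) => k *: w).
  split=> [w a l l'|l a w w'] /=; first by rewrite scalerDl scalerA.
  by rewrite scalerDr !scalerA mulrC.
pose sB := bilinear_isBilinear.Build _ _ _ _ _ _ _ sl.
pose s : {bilinear K^o -> W -> W} :=
  HB.pack (fun (k : K^o) (w : W) => k *: w) sB.
have sc : continuous (fun p : K^o * W => s p.1 p.2) by exact: scale_continuous.
have sd : is_diff (k x, f x) (fun p : K^o * W => s p.1 p.2)
    (fun q => s (k x) q.2 + s q.1 (f x)).
  by apply: DiffDef; [exact: differentiable_bilin|rewrite diff_bilin].
have := @is_diff_comp _ _ _ _ (fun z => (k z, f z)) (fun v => (dk v, df v))
  (fun p : K^o * W => s p.1 p.2) _ x (is_diff_pair kdk fdf) sd.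
exact.
Qed.

End Differentials.

Lemma is_diff_coord {K : numFieldType} {V : normedModType K} (m n : nat)
    (f df : V -> 'M[K]_(m, n)) (x : V) (i : 'I_m) (j : 'I_n) :
  is_diff x f df ->
  is_diff x (fun z => f z i j : K^o) (fun v => df v i j : K^o).
Proof.
move=> fdf.
have cl : linear (fun N : 'M[K]_(m, n) => N i j : K^o).
  by move=> a u v; rewrite !mxE.
pose FL := GRing.isLinear.Build _ _ _ _ _ cl.
pose F : {linear 'M[K]_(m, n) -> K^o} :=
  HB.pack (fun N : 'M[K]_(m, n) => N i j : K^o) FL.
have Fc : continuous F by move=> N; exact: coord_continuous.
have Fd : is_diff (f x) F F.
  by apply: DiffDef; [exact: linear_differentiable|rewrite diff_lin].
exact: (is_diff_comp fdf Fd).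
Qed.

(** * Changes of chart and coordinates of tangent vectors *)

Section Charts.
Context {R : realType} {d : nat} {M : complexManifold R d}.
Implicit Types (c : chart R d M) (x y : M).

(** [chart_inv c] is controlled only on the image of [c], so identities in coordinates hold only
    near [c x]. Openness of the image and continuity of [chart_inv c] on it supply the
    neighbourhood. *)
Lemma near_chart c x (U : set M) :
  chart_dom c x -> open U -> U x ->
  \forall w \near c x, [/\ U (chart_inv c w), chart_dom c (chart_inv c w) &
                          c (chart_inv c w) = w].
Proof.
move=> cx Uo Ux; have cz : (c @` chart_dom c) (c x) by exists x.
have cw : \forall w \near c x, (c @` chart_dom c) w.
  by apply: open_nbhs_nbhs; split=> //; exact: chart_img_open.
have Uw : \forall w \near c x, U (chart_inv c w).
  apply: chart_inv_cont; first exact: mem_set.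
  by apply: open_nbhs_nbhs; rewrite chart_funK.
near=> w.
have [y cy yw] : (c @` chart_dom c) w by near: w.
split; first (by near: w); by rewrite -yw chart_funK.
Unshelve. all: by end_near. Qed.

(** Chain rule: near [c x] the point [chart_inv c w] stays in the domain of [c'], where the middle
    chart cancels. *)
Lemma diff_transition c c' c'' x :
  atlas c -> atlas c' -> atlas c'' ->
  chart_dom c x -> chart_dom c' x -> chart_dom c'' x ->
  forall v, 'd (c'' \o chart_inv c') (c' x) ('d (c' \o chart_inv c) (c x) v) =
            'd (c'' \o chart_inv c) (c x) v.
Proof.
move=> ac ac' ac'' cx c'x c''x v.
apply: near_diff_comp.
- by rewrite /= chart_funK.
- exact: atlas_compatible.
- exact: atlas_compatible.
have := near_chart cx (chart_dom_open c') c'x.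
by apply: filterS => w [c'w _ _] /=; rewrite chart_funK.
Qed.

Lemma diff_chart_id c x (v : 'rV[C R]_d) :
  chart_dom c x -> 'd (c \o chart_inv c) (c x) v = v.
Proof.
move=> cx.
apply: (@diff_eq _ _ _ _ id); apply: is_diff_near (is_diff_id _).
by have := near_chart cx openT I; apply: filterS => w [].
Qed.

Lemma tcoordK c x (v : tangent x) :
  atlas c -> chart_dom c x -> tvec c x (tcoord c v) = v.
Proof.
move=> ac cx; rewrite /tvec /tcoord diff_transition ?diff_chart_id //;
  by [exact: chart_at_dom|exact: chart_at_atlas].
Qed.

Lemma tcoord_chart_at x (v : tangent x) : tcoord (chart_at x) v = v.
Proof. by rewrite /tcoord diff_chart_id //; exact: chart_at_dom. Qed.

Lemma tvec_chart_at x (w : 'rV[C R]_d) : tvec (chart_at x) x w = w.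
Proof. by rewrite /tvec diff_chart_id //; exact: chart_at_dom. Qed.

Lemma vderiv_chart c y (v : tangent y) i :
  atlas c -> chart_dom c y ->
  vderiv (fun u => c u 0 i : (C R)^o) v = tcoord c v 0 i.
Proof.
move=> ac cy; rewrite /vderiv /tcoord.
have h := differentiableP
  (atlas_compatible _ _ (chart_at_atlas y) ac _ (chart_at_dom y) cy).
exact: (diff_eq (is_diff_coord 0 i h)).
Qed.

(** * Coordinate formulas for the Lie derivative and the pullback *)

Section LieDerivative.
Context {W : normedModType (C R)}.
Variables (psi : forall y : M, tangent y).
Variables (A : forall y : M, {linear tangent y -> W}) (x : M).
Hypotheses (psi_holo : holomorphic_field setT psi) (A_holo : holomorphic_form A).

Let c : chart R d M := chart_at x.
(** The coefficients of [A] and, in [s], the components of [psi], as functions of the coordinate [z]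
    of the chart at [x]. *)
Let a i (z : 'rV[C R]_d) : W :=
  A (chart_inv c z) (tvec c (chart_inv c z) (delta_mx 0 i)).
Let s (z : 'rV[C R]_d) : 'rV[C R]_d := tcoord c (psi (chart_inv c z)).

Let cx : chart_dom c x. Proof. exact: chart_at_dom. Qed.
Let ac : atlas c. Proof. exact: chart_at_atlas. Qed.

Let a_diff i : is_diff (c x) (a i) ('d (a i) (c x)).
Proof. by apply: differentiableP; exact: A_holo. Qed.

Let s_diff : is_diff (c x) s ('d s (c x)).
Proof. by apply: differentiableP; exact: psi_holo. Qed.

Let a_at i : a i (c x) = A x (delta_mx 0 i).
Proof.
rewrite -[in RHS](tvec_chart_at x (delta_mx 0 i)).
(* The type of the tangent vector depends on the base point, so the point is replaced in the whole
   expression at once. *)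
exact: (congr1 (fun y => A y (tvec c y (delta_mx 0 i))) (chart_funK cx)).
Qed.

Let A_sum_delta (v : tangent x) : \sum_i v 0 i *: A x (delta_mx 0 i) = A x v.
Proof.
rewrite [in RHS](row_sum_delta v) linear_sum.
by apply: eq_bigr => i _; rewrite linearZ.
Qed.

(** The terms [psi(Y_i) a_i] that the Leibniz rule produces cancel against those in [A([psi, Y])],
    so no derivative of [Y] survives. *)
Lemma lie_derivative_chart (U : set M) (Y : forall y : M, tangent y) :
  open U -> U x -> holomorphic_field U Y ->
  lie_derivative psi A Y x =
  \sum_i (Y x 0 i *: 'd (a i) (c x) (psi x) +
          'd s (c x) (Y x) 0 i *: A x (delta_mx 0 i)).
Proof.
move=> Uo Ux Yh.
pose y (z : 'rV[C R]_d) : 'rV[C R]_d := tcoord c (Y (chart_inv c z)).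
have y_diff : is_diff (c x) y ('d y (c x)).
  by apply: differentiableP; exact: Yh.
have y_at : y (c x) = Y x.
  rewrite -[RHS](tcoord_chart_at).
  exact: (congr1 (fun u => tcoord c (Y u)) (chart_funK cx)).
have AY : is_diff (c x) (fun z => A (chart_inv c z) (Y (chart_inv c z)))
    (fun v => \sum_i (y (c x) 0 i *: 'd (a i) (c x) v +
                      'd y (c x) v 0 i *: a i (c x))).
  apply: (@is_diff_near _ _ _ (fun z => \sum_i (y z 0 i : (C R)^o) *: a i z)).
    have := near_chart cx openT I; apply: filterS => w [_ cw _].
    rewrite -[in RHS](tcoordK (Y (chart_inv c w)) ac cw) -/(y w).
    rewrite [in RHS](row_sum_delta (y w)) /tvec !linear_sum.
    by apply: eq_bigr => i _; rewrite !linearZ.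
  apply: is_diff_sum => i; apply: is_diff_scale_fun => //.
  exact: is_diff_coord.
rewrite /lie_derivative /bracket linearB /=.
have -> : vderiv (fun u => A u (Y u)) (psi x) = _ := diff_eq AY (psi x).
(* At [x] itself [vderiv] uses the chart [c], so both halves of the bracket are by definition
   derivatives of [y] and [s]. *)
rewrite -/c -[vderiv _ (psi x)]/('d y (c x) (psi x)).
rewrite -[vderiv _ (Y x)]/('d s (c x) (Y x)).
rewrite opprB -(A_sum_delta ('d s (c x) (Y x))).
rewrite -(A_sum_delta ('d y (c x) (psi x))) addrA -big_split /=.
rewrite -sumrB; apply: eq_bigr => i _.
by rewrite y_at a_at addrAC addrK.
Qed.

(** Modulo [eps^2], this is the product of [a_i + eps psi(a_i)] with [v_i + eps v(psi_i)], summed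
    over [i]. *)
Lemma eps_pull_form_chart (v : tangent x) :
  eps_pull_form psi (trivial_extension A) v =
  (A x v, \sum_i (v 0 i *: 'd (a i) (c x) (psi x) +
                  'd s (c x) v 0 i *: A x (delta_mx 0 i))).
Proof.
have pull_coord i : eps_d (eps_pull_fun psi (eps_coord c i)) v =
    (v 0 i, 'd s (c x) v 0 i).
  congr pair; first by rewrite -[LHS]/(vderiv (fun u => c u 0 i : (C R)^o) v)
    vderiv_chart // tcoord_chart_at.
  (* The [eps]-part of the pulled back coordinate is [0 + psi(z_i)], which is known to be the
     component [s_i] only near [c x]. *)
  have h : is_diff (c x)
      (fun z => 0 + vderiv (fun u => c u 0 i : (C R)^o) (psi (chart_inv c z)))
      (fun v => 'd s (c x) v 0 i : (C R)^o).
    apply: is_diff_near (is_diff_coord 0 i s_diff).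
    have := near_chart cx openT I; apply: filterS => w [_ cw _].
    by rewrite add0r vderiv_chart.
  exact: (diff_eq h).
have pull_coef i : eps_pull_fun psi (eps_coef (trivial_extension A) c i) x =
    (A x (delta_mx 0 i), 'd (a i) (c x) (psi x)).
  by congr pair; rewrite ?add0r //= tvec_chart_at.
rewrite /eps_pull_form -/c.
under eq_bigr => i _ do rewrite pull_coord pull_coef.
rewrite [LHS]surjective_pairing; congr pair.
  by rewrite -[RHS]A_sum_delta (big_morph fst (id1 := 0) (op1 := +%R)).
by rewrite (big_morph snd (id1 := 0) (op1 := +%R)).
Qed.

End LieDerivative.

(** Since the trivial extension has [eps]-part zero, both inclusions of the theorem are read off
    from the second component. *)
Lemma eps_pull_form_lie_derivative {W : normedModType (C R)}
    (psi : forall y : M, tangent y) (A : forall y : M, {linear tangent y -> W})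
    (U : set M) (Y : forall y : M, tangent y) (x : M) :
  holomorphic_field setT psi -> holomorphic_form A ->
  open U -> U x -> holomorphic_field U Y ->
  eps_pull_form psi (trivial_extension A) (Y x) =
  (A x (Y x), lie_derivative psi A Y x).
Proof.
move=> psi_holo A_holo Uo Ux Yh.
by rewrite (lie_derivative_chart _ A_holo Uo) ?eps_pull_form_chart.
Qed.

End Charts.

Theorem proposition3p1 (R : realType) (n k m d : nat)
  (X : complexManifold R n) (G : complexLieGroup R m) (H : complexLieGroup R k)
  (iota : closed_lie_subgroup H G) (E : complexManifold R d)
  (P : principal_bundle X H E) (A : cartan_geometry iota P)
  (X_compact : compact [set: X])
  (G_connected : connected [set: G]) (H_connected : connected [set: H]) :
  T0 A = [set psi | H0_ad P psi /\ lie_derivative_eq0 psi A].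
Proof.
have A_holo : holomorphic_form A := cartan_holomorphic A.
have [B [AK _ B_holo]] := cartan_iso A.
apply/seteqP; split=> psi [psi_ad psi_A]; split=> //;
  have [psi_holo _ _] := psi_ad.
  move=> U Y Uo Yh x Ux.
  have := eps_pull_form_lie_derivative psi_holo A_holo Uo Ux Yh.
  by rewrite psi_A => -[].
move=> x v.
(* The field [fun e => B e (A x v)] is globally holomorphic and takes the value [v] at [x]. *)
have [Yx Y_holo] := (AK x v, B_holo (A x v)).
have := eps_pull_form_lie_derivative (x := x) psi_holo A_holo openT I Y_holo.
by rewrite Yx (psi_A _ _ openT Y_holo).
Qed.
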